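(* There exists an ultrafilter $\mathcal{U}\subseteq 2^\omega$ on $\omega$ with a subset $A\subseteq\mathcal{U}$ that is closed in $\mathcal{U}$, has cardinality $\mathfrak{c}$, and, as a subset of $2^\omega$, does not have the perfect set property.
   Context: Every subset of $\omega$ is identified with its characteristic function, so an ultrafilter on $\omega$ is regarded as a subset of the Cantor set $2^\omega$ and carries the subspace topology. $\mathfrak{c}=2^{\aleph_0}$. A perfect set in $2^\omega$ is a non-empty closed subset of $2^\omega$ with no isolated points (equivalently, a subset homeomorphic to $2^\omega$). A set $A\subseteq 2^\omega$ has the perfect set property if $A$ is either countable or contains a perfect set in $2^\omega$. *)

(* Defs.v *)
From mathcomp Require Import all_boot.
From mathcomp Require Import boolp classical_sets cardinality filter.
From mathcomp Require Import topology cantor.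

Set Implicit Arguments.
Unset Strict Implicit.
Unset Printing Implicit Defensive.

Local Open Scope classical_set_scope.

(* A family of subsets of nat viewed in the Cantor space: the points that are
   characteristic functions of members of the family. *)
Definition cantor_of (F : set_system nat) : set cantor_space :=
  [set x | F [set n | x n]].

Lemma cantor_ofE (F : set_system nat) (B : set nat) :
  cantor_of F (fun n => `[< B n >]) <-> F B.
Proof.
rewrite /cantor_of /=.
suff -> : [set n | `[< B n >]] = B by [].
by apply/seteqP; split=> n /= /asboolP.
Qed.

(* The library's [perfect_set] also holds of the empty set. *)
Definition perfect_set_property (A : set cantor_space) : Prop :=
  countable A \/
  exists P : set cantor_space, [/\ P !=set0, perfect_set P & P `<=` A].

(* Main.v *)
Require Import Defs.
From mathcomp Require Import all_boot.
From mathcomp Require Import boolp classical_sets cardinality filter.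
From mathcomp Require Import mathcomp_extra wochoice.
From mathcomp Require Import topology cantor.

Local Open Scope classical_set_scope.

(** Let X be a closed subset of the Cantor space, with as many points as the
    whole space, and suppose that its points, seen as subsets of the natural
    numbers, form an independent family: any finitely many of them can be
    intersected with the complements of any finitely many others without
    becoming empty. Then for every subset B of X the points of B together with
    the complements of the points of X outside B generate a proper filter, and
    any ultrafilter U containing it meets X exactly in B. As X is closed, B is
    closed in U. So it is enough to choose for B a Bernstein-like subset of X,
    that is one with as many points as the Cantor space but including no
    nonempty perfect set.

    [indep] parametrises such an X by the Cantor space itself: the k-th bit of
    [indep x] asks whether the first n bits of x form a word of the finite
    list l, where k codes the pair (n, l). Each bit depends on finitely many
    bits of x, so X is a continuous image of a compact space; and for finitely
    many distinct points, n can be taken so large that their words of length n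
    are distinct, after which a suitable l realises any prescribed pattern.

    For B ([bernstein]), closed sets are coded by points of the Cantor space,
    as sets of branches of trees of binary words, and nonempty perfect sets
    have as many points as the Cantor space ([perfect_contains_copy]). For
    every c, two points F (c, true) and F (c, false) are picked in X, and in
    the set coded by c whenever that set meets X in continuum many points. All
    of these points being distinct ([distinct_representatives]), the range of
    F (-, true) has the cardinality of the continuum and misses the point F
    (c, false) of every nonempty perfect subset of X. The choice is a
    recursion along a well-order whose proper initial segments are too small
    to exhaust a perfect set ([initial_well_order]). *)

(** * Words of binary sequences and the topology of the Cantor space *)

Lemma mkseq_eq_leq {x y : nat -> bool} {m n : nat} :
  (m <= n)%N -> mkseq x n = mkseq y n -> mkseq x m = mkseq y m.
Proof.
move=> mn /(congr1 (take m)).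
by rewrite /mkseq -!map_take take_iota (minn_idPl mn).
Qed.

Lemma mkseq_eq_nth {x y : nat -> bool} {n i : nat} :
  (i < n)%N -> mkseq x n = mkseq y n -> x i = y i.
Proof. by move=> ltin /(congr1 (nth false ^~ i)); rewrite !nth_mkseq. Qed.

Lemma mkseq_neq_ex (x y : nat -> bool) :
  x <> y -> exists n, mkseq x n <> mkseq y n.
Proof.
move=> neq; apply: contrapT => /forallNP eqxy; apply: neq.
apply/funext => i; apply: (@mkseq_eq_nth _ _ i.+1) => //.
by apply: contrapT; exact: eqxy.
Qed.

Lemma nbhs_mkseq (x : cantor_space) (n : nat) :
  nbhs x [set y | mkseq y n = mkseq x n].
Proof.
elim: n => [|n IHn]; first exact: filterE.
have xn : nbhs x (proj n @^-1` [set x n]).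
  apply: (@proj_continuous nat (fun=> bool) n x).
  by apply: open_nbhs_nbhs; split=> //; exact: discrete_open.
apply: filterS (filterI IHn xn) => y [yx yn].
by rewrite /= !mkseqS yx -[y n]/(proj n y) yn.
Qed.

(** The converse of [nbhs_mkseq] holds because the topology is that of pointwise
    convergence: sequences sharing ever longer words with x converge to x. *)
Lemma nbhs_cantorP (x : cantor_space) (A : set cantor_space) :
  nbhs x A <-> exists n, [set y | mkseq y n = mkseq x n] `<=` A.
Proof.
split=> [xA|[n nA]]; last exact: filterS nA (nbhs_mkseq x n).
pose F : set_system cantor_space :=
  filter_from setT (fun n => [set y : cantor_space | mkseq y n = mkseq x n]).
have FF : Filter F.
  apply: filter_from_filter; first by exists 0%N.
  move=> i j _ _; exists (maxn i j) => // y /= yx.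
  by split; apply: mkseq_eq_leq yx; rewrite ?leq_maxl ?leq_maxr.
have Fx : {ptws, F --> x}.
  apply/pointwise_cvgP => t; apply: cvg_near_cst.
  by exists t.+1 => // y /= /(mkseq_eq_nth (ltnSn t)).
by have [n _ nA] := Fx _ xA; exists n.
Qed.

Lemma closed_cantorP (C : set cantor_space) (x : cantor_space) : closed C ->
  (forall n, exists2 y, C y & mkseq y n = mkseq x n) -> C x.
Proof.
move=> cC Cx; apply: cC => A /nbhs_cantorP[n nA].
by have [y Cy yx] := Cx n; exists y; split=> //; exact: nA.
Qed.

(** * Nonempty perfect sets have as many points as the Cantor space *)

(** The comparison #T <= #A, as an explicit injection that can be composed. *)
Definition contains_copy (T U : Type) (A : set U) :=
  exists2 h : T -> U, injective h & forall t, A (h t).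

Section PerfectTree.
Variables (P : set cantor_space).
Hypothesis P_perfect : perfect_set P.

(** One branching of the binary tree inside P.  The pair (p, n) stands for the
    point p known up to its first n bits; since p is not isolated, some other
    point of P shares these bits, and the two are told apart further on. *)
Lemma perfect_split (u : cantor_space * nat) : exists v : cantor_space * nat,
  P u.1 -> [/\ P v.1, mkseq v.1 u.2 = mkseq u.1 u.2, (u.2 < v.2)%N &
               mkseq v.1 v.2 <> mkseq u.1 v.2].
Proof.
case: u => p n /=; have [Pp|] := pselect (P p); last by exists (p, n).
have [_ limP] := P_perfect; move: (Pp); rewrite -{1}limP.
move=> /(_ _ (nbhs_mkseq p n)) [q [/eqP qp Pq qpn]].
have [m qpm] := mkseq_neq_ex _ _ qp.
exists (q, maxn n.+1 m) => _; split=> //=; first exact: leq_maxl.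
by move=> /(mkseq_eq_leq (leq_maxr _ _)).
Qed.

Let split (u : cantor_space * nat) := projT1 (cid (perfect_split u)).

Let splitP u : P u.1 ->
  [/\ P (split u).1, mkseq (split u).1 u.2 = mkseq u.1 u.2,
      (u.2 < (split u).2)%N &
      mkseq (split u).1 (split u).2 <> mkseq u.1 (split u).2].
Proof. exact: projT2 (cid (perfect_split u)). Qed.

(** The path along x: bit k of x decides between staying at the current point
    and moving to its alternative.  The level rises in both cases, so that the
    two outcomes differ below a common level. *)
Let descend (p : cantor_space) (x : nat -> bool) := fix loop k :=
  if k is k'.+1 then
    let u := loop k' in ((if x k' then (split u).1 else u.1), (split u).2)
  else (p, 0%N).

(** The point assigned to x is the limit of the path along x: all later points
    of the path agree with the k-th one up to the k-th level.  Two distinct x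
    take different turns at their first difference, and the words read there
    are those of the limits. *)
Lemma perfect_contains_copy : P !=set0 -> contains_copy cantor_space _ P.
Proof.
move=> [p Pp]; pose s := descend p.
have sS x k : s x k.+1 =
    ((if x k then (split (s x k)).1 else (s x k).1), (split (s x k)).2) by [].
have Ps x k : P (s x k).1.
  by elim: k => //= k IHk; case: (x k) => //; have [] := splitP _ IHk.
have step x k : mkseq (s x k.+1).1 (s x k).2 = mkseq (s x k).1 (s x k).2.
  by rewrite /=; case: (x k) => //; have [] := splitP _ (Ps x k).
have lts x k : ((s x k).2 < (s x k.+1).2)%N.
  by have [] := splitP _ (Ps x k).
have les x k j : (k <= j)%N -> ((s x k).2 <= (s x j).2)%N.
  move=> /subnK <-; elim: (j - k)%N => // i IHi.
  exact: leq_trans IHi (ltnW (lts x _)).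
have ge_s x k : (k <= (s x k).2)%N.
  by elim: k => // k IHk; exact: leq_ltn_trans IHk (lts x k).
have stable x k j : (k <= j)%N ->
    mkseq (s x j).1 (s x k).2 = mkseq (s x k).1 (s x k).2.
  move=> /subnK <-; elim: (j - k)%N => // i <-.
  by apply: mkseq_eq_leq (step x _); apply: les; exact: leq_addl.
(* The level at step i.+1 exceeds i, so bit i no longer changes. *)
pose h x : cantor_space := fun i => (s x i.+1).1 i.
have hs x k : mkseq (h x) (s x k).2 = mkseq (s x k).1 (s x k).2.
  apply/eq_in_map => i; rewrite mem_iota add0n => /= ltik; rewrite /h.
  have [leik|ltki] := leqP i.+1 k.
    by rewrite (mkseq_eq_nth (ge_s x i.+1) (stable _ _ _ leik)).
  exact: mkseq_eq_nth ltik (stable _ _ _ (ltnW ltki)).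
exists h => [x y hxy|x]; last first.
  apply: closed_cantorP; first by case: P_perfect.
  move=> n; exists (s x n).1 => //.
  exact: mkseq_eq_leq (ge_s x n) (esym (hs x n)).
suff sxy k : s x k = s y k /\ (forall i, (i < k)%N -> x i = y i).
  by apply/funext => i; have [_] := sxy i.+1; apply.
elim: k => // k [IHs IHk].
have xyk : x k = y k.
  have [_ _ _] := splitP _ (Ps y k).
  have := hs x k.+1; rewrite hxy !sS IHs /=.
  have := hs y k.+1; rewrite !sS /= => ->.
  by case: (x k); case: (y k) => // ->.
split=> [|i]; first by rewrite !sS IHs xyk.
by rewrite ltnS leq_eqVlt => /predU1P[->//|/IHk].
Qed.

End PerfectTree.

(** * Choosing distinct points by transfinite recursion *)

Lemma well_founded_total_order (T : eqType) : exists lt : T -> T -> Prop,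
  well_founded lt /\ forall x y, x <> y -> lt x y \/ lt y x.
Proof.
have [R woR] := well_ordering_principle T.
have Rmin (A : set T) : A !=set0 -> exists2 z, A z & forall x, A x -> R z x.
  move=> [x Ax]; have [|z [[Az Rz] _]] := woR [pred x | `[< A x >]].
    by exists x; exact/asboolP.
  by exists z; [exact/asboolP | move=> y /asboolP; exact: Rz].
exists (fun x y => ~~ R y x); split.
  move=> x; apply: contrapT => nAx.
  have [z nAz Rz] := Rmin [set y | ~ Acc (fun x y => ~~ R y x) y]
    (ex_intro _ x nAx).
  apply: nAz; apply: Acc_intro => y /negP nRzy; apply: contrapT => nAy.
  exact/nRzy/Rz.
move=> x y neq; have [Rxy|] := boolP (R x y); last by right.
have [Ryx|] := boolP (R y x); last by left.
have Rrefl z : R z z.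
  have [|w [[]]] := woR (pred1 z); first by exists z; rewrite inE.
  by rewrite inE => /eqP -> + _; apply; rewrite inE.
(* Both x and y would be minima of the pair, and minima are unique. *)
have [|z [_ zP]] := woR (pred2 x y); first by exists x; rewrite inE eqxx.
by case: neq; rewrite -(zP x) ?(zP y) //; split; rewrite ?inE ?eqxx ?orbT //;
  move=> u; rewrite inE => /orP[]/eqP->.
Qed.

(** A well-order of minimal type.  If an arbitrary well-order has a proper
    initial segment into which T injects, the least element with such a segment
    is taken and the order is pulled back along the injection; the elements of
    that segment have small segments themselves. *)
Lemma initial_well_order (T : eqType) : exists lt : T -> T -> Prop,
  [/\ well_founded lt, forall x y, x <> y -> lt x y \/ lt y x &
      forall x, ~ contains_copy T T [set y | lt y x]].
Proof.
have [lt [wf tot]] := well_founded_total_order T.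
pose big x := contains_copy T T [set y | lt y x].
have [[x0 bigx0]|small] := pselect (exists x, big x); last first.
  by exists lt; split=> // x bigx; apply: small; exists x.
have [x bigx minx] : exists2 x, big x & forall y, lt y x -> ~ big y.
  elim/(well_founded_ind wf): x0 bigx0 => x IHx bigx.
  have [[y ltyx bigy]|nosmaller] := pselect (exists2 y, lt y x & big y).
    exact: IHx ltyx bigy.
  by exists x => // y ltyx bigy; apply: nosmaller; exists y.
have [e inje ltex] := bigx.
exists (fun i j => lt (e i) (e j)); split.
- move=> i; move: {-1}(e i) (erefl (e i)) => u.
  elim/(well_founded_ind wf): u i => u IHu i ei; apply: Acc_intro => j.
  by rewrite ei => ltju; exact: (IHu _ ltju j erefl).
- by move=> i j neq; apply: tot => /inje.
- move=> i [h injh lth]; apply: (minx _ (ltex i)); exists (e \o h) => //.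
  exact: inj_comp.
Qed.

(** At each stage the points already chosen cannot fill the next set: T would
    then inject into the stages passed, against [initial_well_order]. *)
Lemma distinct_representatives (T : eqType) (U : pointedType) (g : T -> set U) :
  (forall i, contains_copy T U (g i)) ->
  exists2 f : T -> U, injective f & forall i, g i (f i).
Proof.
move=> bigg; have [lt [wf tot small]] := initial_well_order T.
pose fresh i (prev : forall j, lt j i -> U) : U :=
  get [set u | g i u /\ forall j ltji, u <> prev j ltji].
pose f := Fix wf (fun=> U) fresh.
have fE i : f i = fresh i (fun j _ => f j).
  rewrite /f Fix_eq // => j p q pq; congr fresh.
  by apply: functional_extensionality_dep => k;
    apply: functional_extensionality_dep.
have fP i : g i (f i) /\ forall j, lt j i -> f i <> f j.
  suff : [set u | g i u /\ forall j, lt j i -> u <> f j] (f i) by [].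
  rewrite fE; apply: getPex; apply: contrapT => nofresh.
  have [h injh gh] := bigg i.
  have hf t : exists j, lt j i /\ h t = f j.
    apply: contrapT => nhf; apply: nofresh; exists (h t); split=> // j ltji hj.
    by apply: nhf; exists j.
  pose r t := projT1 (cid (hf t)).
  have rP t : lt (r t) i /\ h t = f (r t) := projT2 (cid (hf t)).
  apply: (small i); exists r => [t t' rtt'|t]; last by have [] := rP t.
  by apply: injh; have [_ ->] := rP t; have [_ ->] := rP t'; rewrite rtt'.
exists f => [i j fij|i]; last by have [] := fP i.
apply: contrapT => neq; have [ltij|ltji] := tot _ _ neq.
  by have [_ /(_ _ ltij)] := fP j; rewrite fij.
by have [_ /(_ _ ltji)] := fP i.
Qed.

(** * A Bernstein-like set *)

(** The closed set of infinite branches through the tree of words coded by c. *)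
Definition branches (c : nat -> bool) : set cantor_space :=
  [set x | forall n, c (pickle (mkseq x n))].

Lemma closed_branches (C : set cantor_space) :
  closed C -> exists c : cantor_space, branches c = C.
Proof.
move=> cC.
exists (fun k => `[< exists x n, C x /\ k = pickle (mkseq x n) >]).
apply/seteqP; split=> x; last by move=> Cx n; apply/asboolP; exists x, n.
move=> xT; apply: (closed_cantorP _ _ cC) => n.
have /asboolP[y [m [Cy]]] := xT n.
move=> /(pcan_inj pickleK) xy; exists y => //.
by have := congr1 size xy; rewrite !size_mkseq xy => ->.
Qed.

(** Two distinct families of representatives, indexed by the boolean, are chosen
    at once: one is kept, the other one witnesses that no nonempty perfect set
    is swallowed. *)
Lemma bernstein (X : set cantor_space) : contains_copy cantor_space _ X ->
  exists f : cantor_space -> cantor_space, [/\ injective f,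
    range f `<=` X &
    forall P, perfect_set P -> P `<=` range f -> P = set0].
Proof.
move=> bigX.
(* Codes of sets meeting X in few points are sent to X itself, so that
   every index has enough candidates. *)
pose g (i : cantor_space * bool) : set cantor_space :=
  if `[< contains_copy cantor_space _ (branches i.1 `&` X) >]
  then branches i.1 `&` X else X.
have gX i : g i `<=` X.
  by rewrite /g; case: ifP => _; [exact: subIsetr | exact: subset_refl].
(* The candidates come as a copy of the Cantor space and the indices as pairs;
   pairs embed into the Cantor space. *)
pose merge (i : cantor_space * bool) : cantor_space :=
  fun n => if n is m.+1 then i.1 m else i.2.
have merge_inj : injective merge.
  move=> [x a] [y b] xy; congr pair; last exact: (congr1 (fun z => z 0%N) xy).
  by apply/funext => n; exact: (congr1 (fun z => z n.+1) xy).
have [|F injF gF] := distinct_representatives _ _ g.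
  move=> i; suff [h injh gh] : contains_copy cantor_space _ (g i).
    by exists (h \o merge) => [|t]; [exact: inj_comp | exact: gh].
  by rewrite /g; case: ifP => // /asboolP.
exists (fun x => F (x, true)); split.
- by move=> x y /injF [].
- by move=> _ [x _ <-]; exact: gX (gF _).
- move=> P perfP PF; apply/eqP; apply: contrapT => /negP/set0P P0.
  have [c cP] := closed_branches P (proj1 perfP).
  have : g (c, false) (F (c, false)) by exact: gF.
  rewrite /g /= cP; have PX : P `&` X = P.
    by apply/setIidl => x /PF[y _ <-]; exact: gX (gF _).
  rewrite PX asboolT; last exact: perfect_contains_copy.
  by move=> /PF[x _ /injF].
Qed.

(** * A closed independent family and the ultrafilters splitting it *)

(** The independent family of Fichtenholz and Kantorovich, with index set the
    pairs of a length and a finite list of words, coded by natural numbers. *)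
Definition indep (x : cantor_space) : cantor_space := fun k =>
  if unpickle k is Some (n, l) then mkseq x n \in (l : seq bitseq) else false.

(** Independence: beyond a length n at which the words of the points of s become
    distinct, the list of the words of the points in B separates B on s. *)
Lemma indep_independent (s : seq cantor_space) (B : set cantor_space) :
  exists k, forall x, x \in s -> indep x k = `[< B x >].
Proof.
have sepP (x y : cantor_space) :
    exists n, x <> y -> mkseq x n <> mkseq y n.
  have [->|/eqP neq] := eqVneq x y; first by exists 0%N.
  by have [n] := mkseq_neq_ex _ _ neq; exists n.
pose sep x y := projT1 (cid (sepP x y)).
pose n := (\max_(x <- s) \max_(y <- s) sep x y)%N.
have n_inj x y : x \in s -> y \in s -> mkseq x n = mkseq y n -> x = y.
  move=> xs ys xyn; apply: contrapT => /(projT2 (cid (sepP x y))); apply.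
  apply: mkseq_eq_leq xyn; rewrite -/(sep x y).
  apply: leq_trans (leq_bigmax_seq x xs isT).
  exact: (leq_bigmax_seq y ys isT).
pose l : seq bitseq := [seq mkseq x n | x <- s & `[< B x >]].
exists (pickle (n, l)) => x xs; rewrite /indep pickleK.
apply/mapP/idP => [[y]|Bx]; last by exists x; rewrite // mem_filter Bx.
by rewrite mem_filter => /andP[By ys] /n_inj -> .
Qed.

Lemma indep_inj : injective indep.
Proof.
move=> x y xy; apply: contrapT => neq.
have [k kP] := indep_independent [:: x; y] [set x].
have := kP x; rewrite inE eqxx => /(_ isT); rewrite asboolT // xy kP.
  by move=> /asboolP/esym.
by rewrite !inE eqxx orbT.
Qed.

(** Each bit of [indep x] is determined by finitely many bits of x, hence
    [indep] is continuous and its range compact. *)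
Lemma closed_range_indep : closed (range indep).
Proof.
apply: compact_closed; first exact: cantor_space_hausdorff.
apply: continuous_compact; last exact: cantor_space_compact.
apply: continuous_subspaceT => x.
suff : {ptws, indep @ nbhs x --> indep x} by [].
apply/pointwise_cvgP => k; apply: cvg_near_cst; apply/nbhs_cantorP.
suff [n nx] : exists n, forall y : cantor_space,
    mkseq y n = mkseq x n -> indep y k = indep x k by exists n.
rewrite /indep; case: (unpickle k) => [[n l]|]; last by exists 0%N.
by exists n => y ->.
Qed.

(** Independence is exactly the finite intersection property of the sets
    [indep x] for x in B and their complements for x outside B. *)
Lemma ultrafilter_splitting_indep (B : set cantor_space) :
  exists2 F : set_system nat, UltraFilter F &
    forall x, cantor_of F (indep x) <-> B x.
Proof.
pose F0 : set_system nat := [set A | exists s : seq cantor_space,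
  [set k | forall x, x \in s -> indep x k = `[< B x >]] `<=` A].
have FF0 : ProperFilter F0.
  split.
    by move=> [s sP]; have [k kP] := indep_independent s B; exact: (sP k).
  split.
  - by exists [::].
  - move=> A A' [s sA] [s' sA']; exists (s ++ s') => k kP.
    by split; [apply: sA | apply: sA'] => x xs;
      apply: kP; rewrite mem_cat xs ?orbT.
  - by move=> A A' AA' [s sA]; exists s; exact: subset_trans AA'.
have [F [FU F0F]] := ultraFilterLemma FF0; exists F => // x.
have split_x : F [set k | indep x k = `[< B x >]].
  by apply: F0F; exists [:: x] => k /=; apply; rewrite inE.
split=> [Fx|Bx]; last by move: split_x; rewrite asboolT.
apply: contrapT => nBx; move: split_x; rewrite asboolF // => Fnx.
have [k [/= ->]] := filter_ex (filterI Fx Fnx).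
by [].
Qed.

(** Cantor's diagonal argument: d differs at e (f x) from each x. *)
Lemma uncountable_range (f : cantor_space -> cantor_space) :
  injective f -> ~ countable (range f).
Proof.
move=> injf /countable_injP[e inje].
pose d : cantor_space := fun n => `[< exists x, e (f x) = n /\ ~~ x n >].
have [dd|ndd] := boolP (d (e (f d))).
  have /asboolP[x [efx]] := dd.
  suff -> : x = d by rewrite dd.
  by apply: injf; apply: inje efx; rewrite inE; [exists x | exists d].
by case/negP: (ndd); apply/asboolP; exists d.
Qed.

Theorem theorem28 :
  exists F : set_system nat, UltraFilter F /\
  exists A : set cantor_space,
    [/\ A `<=` cantor_of F,
        closed (A : set (subspace (cantor_of F))),
        (A #= [set: cantor_space])%card &
        ~ perfect_set_property A].
Proof.
have [|f [injf fX noperf]] := bernstein (range indep).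
  by exists indep => [|x]; [exact: indep_inj | exists x].
have [F FU FP] := ultrafilter_splitting_indep [set x | range f (indep x)].
have AE : range f = range indep `&` cantor_of F.
  apply/seteqP; split=> [y fy|y [[x _ <-] /FP//]].
  have [x _ xy] := fX _ fy; split; first by exists x.
  by rewrite -xy; apply/FP; rewrite /= xy.
exists F; split=> //; exists (range f); split.
- by rewrite AE; exact: subIsetr.
- apply/closed_subspaceP; exists (range indep).
    exact: closed_range_indep.
  by rewrite AE -setIA setIid.
- by apply: inj_card_eq => x y _ _; exact: injf.
- case; first exact: uncountable_range.
  by move=> [P [[x Px] perfP /(noperf _ perfP) P0]]; rewrite P0 in Px.
Qed.
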